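(* For every integer $n\geq 1$, the number $\frac{(2n-1)!!+(-1)^{(n-1)(n-2)/2}}{2}$ is a positive integer, and its $2$-adic valuation equals that of $n$: $\nu_2\!\left(\frac{(2n-1)!!+(-1)^{(n-1)(n-2)/2}}{2}\right)=\nu_2(n)$.
   Context: $(2n-1)!!=1\cdot 3\cdot 5\cdots(2n-1)$. For a positive integer $m$, $\nu_2(m)$ denotes the exponent of the highest power of $2$ dividing $m$. *)

(* Defs.v *)
From mathcomp Require Import all_boot all_order all_algebra.

(* [odd_dfact n] is (2n-1)!! = 1 * 3 * 5 * ... * (2n-1). *)
Definition odd_dfact (n : nat) : nat := \prod_(1 <= k < n.+1) (2 * k - 1).

(* Main.v *)
Require Import Defs.
From mathcomp Require Import all_boot all_order all_algebra.
From mathcomp Require Import zify ring lra.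
Local Open Scope ring_scope.

(** Write P n for (2n-1)!!.  Since P (n+4) = P n mod 8, the residue of P n mod 8
    settles the case where 4 does not divide n.  If m = 2r is even, the factors
    of P m and of P (2m) / P m can be paired so that corresponding pairs are
    c_i and c_i + 8 m^2; hence P (2m) = (P m)^2 mod 8 m^2.  Squaring
    P m = 1 + 2^(v+1) mod 2^(v+2) then increases v by one, so for v >= 2 and
    n = 2^v q with q odd, P n - 1 is 2^(v+1) times an odd number. *)

Import GRing.Theory.
Local Open Scope nat_scope.

Lemma odd_dfactE n : odd_dfact n = \prod_(0 <= i < n) (2 * i + 1).
Proof.
rewrite /odd_dfact big_add1 /=.
by apply: eq_bigr => i _; lia.
Qed.

Lemma odd_dfactS n : odd_dfact n.+1 = odd_dfact n * (2 * n + 1).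
Proof. by rewrite !odd_dfactE big_nat_recr. Qed.

(** Going from [4 * i] to [4 * i.+1] brings in four factors congruent to 1, 3, 5, 7 mod 8, and their
    product 105 is 1 mod 8. *)
Lemma odd_dfact_mod8 j :
  [/\ odd_dfact (4 * j) %% 8 = 1, odd_dfact (4 * j + 1) %% 8 = 1,
      odd_dfact (4 * j + 2) %% 8 = 3 & odd_dfact (4 * j + 3) %% 8 = 7].
Proof.
have step i : odd_dfact (4 * i) %% 8 = 1 ->
  [/\ odd_dfact (4 * i + 1) %% 8 = 1, odd_dfact (4 * i + 2) %% 8 = 3,
      odd_dfact (4 * i + 3) %% 8 = 7 & odd_dfact (4 * i.+1) %% 8 = 1].
  move=> h0.
  have h1 : odd_dfact (4 * i + 1) %% 8 = 1.
    rewrite addn1 odd_dfactS -modnMm h0.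
    by have -> : (2 * (4 * i) + 1) %% 8 = 1 by lia.
  have h2 : odd_dfact (4 * i + 2) %% 8 = 3.
    rewrite (_ : 4 * i + 2 = (4 * i + 1).+1) ?odd_dfactS; last by lia.
    rewrite -modnMm h1.
    by have -> : (2 * (4 * i + 1) + 1) %% 8 = 3 by lia.
  have h3 : odd_dfact (4 * i + 3) %% 8 = 7.
    rewrite (_ : 4 * i + 3 = (4 * i + 2).+1) ?odd_dfactS; last by lia.
    rewrite -modnMm h2.
    by have -> : (2 * (4 * i + 2) + 1) %% 8 = 5 by lia.
  split=> //.
  rewrite (_ : 4 * i.+1 = (4 * i + 3).+1) ?odd_dfactS; last by lia.
  rewrite -modnMm h3.
  by have -> : (2 * (4 * i + 3) + 1) %% 8 = 7 by lia.
have h0 : odd_dfact (4 * j) %% 8 = 1.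
  elim: j => [|j /step[]//].
  by rewrite muln0 odd_dfactE big_geq.
by have [] := step j h0.
Qed.

Lemma prod_nat_fold (F : nat -> nat) r :
  \prod_(0 <= i < 2 * r) F i =
  \prod_(0 <= i < r) (F i * F (2 * r - i.+1)).
Proof.
rewrite (@big_cat_nat _ _ _ r) //=; last by lia.
rewrite big_split /=; congr (_ * _).
rewrite big_nat_rev -{1}[r]add0n big_addn /= (_ : 2 * r - r = r); last by lia.
by apply: eq_big_nat => i hi; congr F; lia.
Qed.

Lemma prod_modn_addl (c : nat -> nat) d r :
  \prod_(0 <= i < r) (d + c i) = \prod_(0 <= i < r) c i %[mod d].
Proof.
elim: r => [|r IH]; first by rewrite !big_geq.
by rewrite !big_nat_recr //= -modnMm IH modnDl modnMm.
Qed.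

Lemma odd_dfact_double r :
  odd_dfact (4 * r) = odd_dfact (2 * r) ^ 2 %[mod 32 * r ^ 2].
Proof.
have E : odd_dfact (4 * r) =
    odd_dfact (2 * r) * \prod_(0 <= i < 2 * r) (4 * r + (2 * i + 1)).
  rewrite !odd_dfactE (@big_cat_nat _ _ _ (2 * r)) //=; last by lia.
  congr (_ * _).
  rewrite -{1}[2 * r]add0n big_addn (_ : 4 * r - 2 * r = 2 * r); last by lia.
  by apply: eq_bigr => i _; lia.
rewrite E -mulnn -[LHS]modnMmr -[RHS]modnMmr; congr ((_ * _) %% _).
rewrite odd_dfactE !prod_nat_fold -[RHS]prod_modn_addl; congr (_ %% _).
apply: eq_big_nat => i /andP[_ lt_ir].
(* With x = 2i + 1 the claim is (4r + x)(8r - x) = 32r^2 + x(4r - x). Writing r as i + k + 1 removes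
   the truncated subtraction, so that [ring] applies. *)
have [k ->] : exists k, r = i + k.+1 by exists (r - i.+1); lia.
have -> : 2 * (i + k.+1) - i.+1 = i + 2 * k + 1 by lia.
ring.
Qed.

Lemma odd_dfact_pow2 v q : odd q ->
  exists t, odd_dfact (2 ^ v.+2 * q) = 1 + 2 ^ v.+3 * (2 * t + 1).
Proof.
move=> odd_q; elim: v => [|v [t IH]].
  have [r Er] : exists r, q = 2 * r + 1 by exists q./2; lia.
  have [_ _ h2 _] := odd_dfact_mod8 r.
  have := odd_dfact_double q.
  rewrite (_ : 2 * q = 4 * r + 2); last by lia.
  rewrite (_ : 2 ^ 2 * q = 4 * q) //.
  set a := odd_dfact (4 * q) => /(congr1 (modn^~ 16)).
  have dv : 16 %| 32 * q ^ 2 by apply: dvdn_mulr.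
  rewrite !modn_dvdm //.
  (* Base case: the square of a number that is 3 mod 8 is 9 mod 16, and 9 + 16t = 1 + 8(2t + 1). *)
  rewrite (divn_eq (odd_dfact (4 * r + 2)) 8) h2; set k := _ %/ 8 => ha.
  have {}ha : a %% 16 = 9.
    rewrite ha (_ : (k * 8 + 3) ^ 2 = (4 * k ^ 2 + 3 * k) * 16 + 9).
      by rewrite modnMDl.
    ring.
  exists (a %/ 16); rewrite {1}(divn_eq a 16) ha; lia.
have := odd_dfact_double (2 ^ v.+1 * q).
have -> : 4 * (2 ^ v.+1 * q) = 2 ^ v.+3 * q by rewrite !expnS; lia.
have -> : 2 * (2 ^ v.+1 * q) = 2 ^ v.+2 * q by rewrite !expnS; lia.
rewrite IH; set a := odd_dfact _ => /(congr1 (modn^~ (2 ^ v.+4 * 2))).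
have dv : 2 ^ v.+4 * 2 %| 32 * (2 ^ v.+1 * q) ^ 2.
  apply/dvdnP; exists (2 ^ v.+2 * q ^ 2); rewrite !expnS; ring.
(* Modulo 2^(v+5), the cross term of the square leaves 2^(v+4), since 2t + 1 is odd, and the last
   term, a multiple of 2^(2v+6), vanishes. *)
rewrite !modn_dvdm // (_ : (1 + 2 ^ v.+3 * (2 * t + 1)) ^ 2 =
    (t + 2 ^ v.+1 * (2 * t + 1) ^ 2) * (2 ^ v.+4 * 2) + (2 ^ v.+4 + 1));
  last first.
  by rewrite !expnS; ring.
have lt1 : 1 < 2 ^ v.+4 by rewrite -(expn0 2) ltn_exp2l.
rewrite modnMDl (@modn_small (2 ^ v.+4 + 1)); last by lia.
move=> ha; exists (a %/ (2 ^ v.+4 * 2)).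
rewrite {1}(divn_eq a (2 ^ v.+4 * 2)) ha; ring.
Qed.

Lemma logn2_pow_odd v t : logn 2 (2 ^ v * (2 * t + 1)) = v.
Proof.
rewrite lognM ?expn_gt0 ?addn1 // lognX logn_prime // muln1 lognE /= dvdn2 /=.
by rewrite oddM addn0.
Qed.

(** Subtraction-free form of P n + (-1)^s = 2^(v+1) (2t + 1), with v = [logn 2 n]: the sign +1 is
    added on the left when [s] is false, and -1 is moved to the right when [s] is true. *)
Lemma odd_dfact_pm1 n : 0 < n ->
  let s := odd ((n - 1) * (n - 2) %/ 2) in
  exists t, odd_dfact n + ~~ s = 2 ^ (logn 2 n).+1 * (2 * t + 1) + s.
Proof.
move=> n_gt0 /=.
have half a b : a = b * 2 -> a %/ 2 = b by move=> ->; rewrite mulnK.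
have [j [c lt_c En]] : exists j, exists2 c, c < 4 & n = 4 * j + c.
  by exists (n %/ 4), (n %% 4); [rewrite ltn_mod | rewrite mulnC -divn_eq].
have [h0 h1 h2 h3] := odd_dfact_mod8 j.
case: c lt_c En => [|[|[|[|//]]]] _ En.
- have -> : (n - 1) * (n - 2) %/ 2 = (n - 1) * (2 * j - 1) by apply: half; nia.
  have -> : odd ((n - 1) * (2 * j - 1)) by rewrite oddM; apply/andP; lia.
  have [q cop Eq] := @pfactor_coprime 2 n isT n_gt0.
  have odd_q : odd q by rewrite -coprime2n.
  (* Here 4 divides n, so the valuation is at least 2. *)
  have [v Ev] : exists v, logn 2 n = v.+2.
    exists (logn 2 n).-2; have := @pfactor_dvdn 2 2 n isT n_gt0.
    by rewrite En addn0 dvdn_mulr //; case: (logn 2 _) => [|[]].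
  have [t Et] := odd_dfact_pow2 v _ odd_q.
  by exists t; rewrite {1}Eq Ev mulnC Et /= addn0 addnC.
- have -> : (n - 1) * (n - 2) %/ 2 = 2 * j * (n - 2) by apply: half; lia.
  rewrite oddM oddM /=.
  have -> : logn 2 n = 0.
    by rewrite (_ : n = 2 ^ 0 * (2 * (2 * j) + 1)) ?logn2_pow_odd //; lia.
  (* P n is 1 mod 4 and the sign is +1, so the sum is 2 mod 4. *)
  by exists (odd_dfact n %/ 4); rewrite En; lia.
- have -> : (n - 1) * (n - 2) %/ 2 = 2 * j * (n - 1) by apply: half; nia.
  rewrite oddM oddM /=.
  have -> : logn 2 n = 1.
    by rewrite (_ : n = 2 ^ 1 * (2 * j + 1)) ?logn2_pow_odd //; lia.
  (* P n is 3 mod 8 and the sign is +1, so the sum is 4 mod 8. *)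
  by exists (odd_dfact n %/ 8); rewrite En; lia.
have -> : (n - 1) * (n - 2) %/ 2 = (2 * j + 1) * (n - 2) by apply: half; nia.
have -> : odd ((2 * j + 1) * (n - 2)) by rewrite oddM; apply/andP; lia.
have -> : logn 2 n = 0.
  by rewrite (_ : n = 2 ^ 0 * (2 * (2 * j + 1) + 1)) ?logn2_pow_odd //; lia.
(* P n is 3 mod 4 and the sign is -1, so the sum is 2 mod 4. *)
by exists (odd_dfact n %/ 4); rewrite En; lia.
Qed.

Local Open Scope ring_scope.

Theorem theorem1 (n : nat) (hn : (1 <= n)%N) :
  exists m : nat,
    [/\ (0 < m)%N,
        ((odd_dfact n)%:R + (-1) ^+ ((n - 1) * (n - 2) %/ 2)%N) / 2%:R
          = m%:R :> rat
      & logn 2 m = logn 2 n].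
Proof.
have [t Et] := odd_dfact_pm1 n hn.
exists (2 ^ logn 2 n * (2 * t + 1))%N; split; last exact: logn2_pow_odd.
  by rewrite muln_gt0 expn_gt0 addn1.
(* Only the parity of the exponent matters; both signs then follow by casting the natural-number
   identity to [rat]. *)
rewrite -signr_odd; move: (odd _) Et => s.
rewrite expnS -mulnA; move: (2 ^ logn 2 n * _)%N => m Et.
have -> : (odd_dfact n)%:R + (-1) ^+ s = 2%:R * m%:R :> rat.
  have := congr1 (fun k => k%:R : rat) Et.
  by rewrite /= natrD [RHS]natrD natrM; case: s {Et} => /=; lra.
by rewrite mulrC mulKf.
Qed.
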